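(* For all integers $a\geq 0$ and $b\geq 0$: $$n(a,b,4)=\begin{cases}\infty & \text{if } a<2,\\ 2a & \text{if } a=2 \text{ and } b=0,\\ a+b+1 & \text{if } a=2 \text{ and } b\geq 1,\\ 2a & \text{if } a\geq 3,\ a>b \text{ and } ab \text{ is even},\\ 2a+2 & \text{if } a\geq 3,\ a>b \text{ and } ab \text{ is odd},\\ a+b+1 & \text{if } 3\leq a\leq b \text{ and } a\not\equiv b \pmod 2,\\ a+b+2 & \text{if } 3\leq a\leq b \text{ and } a,b \text{ both odd},\\ a+b+2 & \text{if } 3\leq a\leq b,\ a,b \text{ both even and } b\leq \tfrac{3a}{2}-2,\\ a+b+1 & \text{if } 3\leq a\leq b,\ a,b \text{ both even and } b> \tfrac{3a}{2}-2.\end{cases}$$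
   Context: A weighted graph (wgraph) is a pair $G=(L,H)$ of simple finite graphs with $V(L)=V(H)$ and $E(L)\cap E(H)=\varnothing$; edges of $L$ are light (weight 1) and edges of $H$ are heavy (weight 2). A wcycle is a cycle (of length at least 3) in the graph with edge set $E(L)\cup E(H)$; its weight is the sum of the weights of its edges. The girth of $G$ is the minimum weight of a wcycle. $G$ is $(a,b)$-regular if $L$ is $a$-regular and $H$ is $b$-regular. An $(a,b,g)$-wgraph is an $(a,b)$-regular wgraph of girth $g$. $n(a,b,g)$ denotes the minimum order of an $(a,b,g)$-wgraph, and $n(a,b,g)=\infty$ if none exists. *)

(* Defs.v *)
From mathcomp Require Import all_boot all_order all_algebra.
From mathcomp Require Import boolp.

Set Implicit Arguments.
Unset Strict Implicit.
Unset Printing Implicit Defensive.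

(* The minimum of {n | P n}, with [None] standing for infinity: it is the
   value exactly when no n satisfies P. *)
Definition min_nat (P : nat -> Prop) : option nat :=
  if pselect (exists n, `[< P n >]) is left exP then Some (ex_minn exP)
  else None.

Lemma min_nat_SomeP (P : nat -> Prop) (m : nat) :
  min_nat P = Some m <-> P m /\ (forall n, P n -> m <= n).
Proof.
rewrite /min_nat; case: pselect => [exP | nP]; last first.
  by split=> // -[Pm _]; case: nP; exists m; apply/asboolP.
case: ex_minnP => k Pb k_min; have Pk := asboolW Pb; split=> [[<-] | [Pm m_min]].
  by split=> // n Pn; apply: k_min; apply/asboolP.
congr Some; apply/eqP; rewrite eqn_leq m_min // andbT.
by apply: k_min; apply/asboolP.
Qed.

Lemma min_nat_NoneP (P : nat -> Prop) :
  min_nat P = None <-> (forall n, ~ P n).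
Proof.
rewrite /min_nat; case: pselect => [exP | nP].
  by split=> // noP; case: (exP) => n Pn; case: (noP n); apply: asboolW.
by split=> // _ n Pn; apply: nP; exists n; apply/asboolP.
Qed.

Record sgraph (V : finType) := SGraph {
  edge :> rel V;
  edge_sym : symmetric edge;
  edge_irr : irreflexive edge }.

Definition regular (V : finType) (d : nat) (G : sgraph V) : Prop :=
  forall x : V, #|[set y | G x y]| = d.

Record wgraph (V : finType) := WGraph {
  light : sgraph V;
  heavy : sgraph V;
  light_heavy_disjoint : forall x y, ~~ (light x y && heavy x y) }.

Definition adj (V : finType) (G : wgraph V) : rel V :=
  fun x y => light G x y || heavy G x y.

(* Only used on pairs of adjacent vertices. *)
Definition edge_weight (V : finType) (G : wgraph V) (x y : V) : nat :=
  if heavy G x y then 2 else 1.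

(* A cycle is given by the list of its distinct vertices in cyclic order. *)
Definition wcycle (V : finType) (G : wgraph V) (c : seq V) : Prop :=
  3 <= size c /\ ucycle (adj G) c.

Definition weight (V : finType) (G : wgraph V) (c : seq V) : nat :=
  \sum_(x <- c) edge_weight G x (next c x).

Definition girth (V : finType) (G : wgraph V) : option nat :=
  min_nat (fun w => exists2 c, wcycle G c & weight G c = w).

Definition ab_regular (V : finType) (a b : nat) (G : wgraph V) : Prop :=
  regular a (light G) /\ regular b (heavy G).

Definition abg_wgraph (V : finType) (a b g : nat) (G : wgraph V) : Prop :=
  ab_regular a b G /\ girth G = Some g.

Definition min_order (a b g : nat) : option nat :=
  min_nat (fun n =>
    exists (V : finType) (G : wgraph V), #|V| = n /\ abg_wgraph a b g G).

(* Main.v *)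
(* Girth 4 means that the light graph L is triangle-free and that there is a
   light 4-cycle or a light path of length 2 closed by a heavy edge; the latter
   is automatic when H is the complement of L and a >= 2.
   Lower bounds: degrees give n >= a + b + 1, triangle-freeness n >= 2a, and
   handshakes (also inside one side of L = K_{a,a} when n = 2a) the parity
   constraints; if 2n < 5a then L is bipartite by Andrasfai, so n is even.
   Upper bounds: for even n, L joins (false, x) to (true, y) in bool * Z_m
   according to x + y, and H consists of circulants on the sides plus further
   sums across; for odd n (a, b even, 2n >= 5a), L is an unbalanced blow-up of
   the pentagon and H its complement. *)
Require Import Defs.
From mathcomp Require Import all_boot all_order all_algebra.
From mathcomp Require Import zify lra.

Set Implicit Arguments.
Unset Strict Implicit.
Unset Printing Implicit Defensive.

Import GRing.Theory.

(** * Girth 4 in terms of the light graph *)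

Definition triangle_free (V : finType) (L : sgraph V) : Prop :=
  forall x y z : V, L x y -> L y z -> ~~ L x z.

Section GirthFour.

Variables (V : finType) (G : wgraph V).

Lemma edge_weight_gt0 (x y : V) : 0 < edge_weight G x y.
Proof. by rewrite /edge_weight; case: ifP. Qed.

Lemma size_le_weight (c : seq V) : size c <= weight G c.
Proof.
rewrite /weight -sum1_size; apply: leq_sum => x _; exact: edge_weight_gt0.
Qed.

Lemma light_not_heavy (x y : V) : light G x y -> heavy G x y = false.
Proof.
by move=> Lxy; have := light_heavy_disjoint G x y; rewrite Lxy => /negbTE.
Qed.

Lemma edge_weight_light (x y : V) : light G x y -> edge_weight G x y = 1.
Proof. by move=> Lxy; rewrite /edge_weight light_not_heavy. Qed.

Lemma edge_weight_heavy (x y : V) : heavy G x y -> edge_weight G x y = 2.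
Proof. by rewrite /edge_weight => ->. Qed.

Lemma sgraph_neq (L : sgraph V) (x y : V) : L x y -> x != y.
Proof. by apply: contraTneq => ->; rewrite edge_irr. Qed.

Lemma weight3 (x y z : V) : uniq [:: x; y; z] ->
  weight G [:: x; y; z] =
  edge_weight G x y + (edge_weight G y z + edge_weight G z x).
Proof.
rewrite /= !inE !andbT negb_or => /andP[/andP[xy xz] yz].
rewrite /weight !big_cons big_nil addn0 /= !eqxx.
by rewrite (eq_sym y x) (eq_sym z x) (eq_sym z y) (negbTE xy) (negbTE xz) (negbTE yz).
Qed.

Lemma weight4 (x y z t : V) : uniq [:: x; y; z; t] ->
  weight G [:: x; y; z; t] =
  edge_weight G x y + (edge_weight G y z
    + (edge_weight G z t + edge_weight G t x)).
Proof.
rewrite /= !inE !andbT !negb_or => /and3P[/and3P[xy xz xt] /andP[yz yt] zt].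
rewrite /weight !big_cons big_nil addn0 /= !eqxx.
rewrite (eq_sym y x) (eq_sym z x) (eq_sym z y) (eq_sym t x) (eq_sym t y).
rewrite (eq_sym t z) (negbTE xy) (negbTE xz) (negbTE yz).
by rewrite (negbTE xt) (negbTE yt) (negbTE zt).
Qed.

Lemma girth4_triangle_free : girth G = Some 4 -> triangle_free (light G).
Proof.
move/min_nat_SomeP=> [_ ge4] x y z Lxy Lyz; apply/negP=> Lxz.
have Lzx : light G z x by rewrite edge_sym.
have U : uniq [:: x; y; z].
  by rewrite /= !inE negb_or (sgraph_neq Lxy) (sgraph_neq Lxz) (sgraph_neq Lyz).
suff: 4 <= 3 by [].
apply: ge4; exists [:: x; y; z]; last by rewrite weight3 // !edge_weight_light.
by split=> //; rewrite /ucycle U /= /adj Lxy Lyz Lzx.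
Qed.

(** Every edge weighs at least 1, so only a triangle could weigh less than 4; one of its edges is
    heavy, which brings it to at least 2 + 1 + 1. *)
Lemma triangle_free_weight_ge4 (c : seq V) :
  triangle_free (light G) -> wcycle G c -> 4 <= weight G c.
Proof.
move=> tf [c3 cyc]; have := size_le_weight c.
case: (ltnP 3 (size c)) => [c4 le_w|c_le3 _]; first exact: leq_trans le_w.
case: c cyc c3 c_le3 => [|x [|y [|z [|? ?]]]] //= /andP[/=].
rewrite andbT => /and3P[xy yz zx] U _ _; rewrite weight3 //.
have := (edge_weight_gt0 x y, edge_weight_gt0 y z, edge_weight_gt0 z x).
case=> [[w_xy w_yz] w_zx].
case Hxy: (heavy G x y); first by rewrite (edge_weight_heavy Hxy); lia.
case Hyz: (heavy G y z); first by rewrite (edge_weight_heavy Hyz); lia.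
case Hzx: (heavy G z x); first by rewrite (edge_weight_heavy Hzx); lia.
move: xy yz zx; rewrite /adj Hxy Hyz Hzx !orbF => xy yz.
by rewrite edge_sym (negbTE (tf _ _ _ xy yz)).
Qed.

Lemma girth4_of_cycle (c : seq V) :
  triangle_free (light G) -> wcycle G c -> weight G c = 4 -> girth G = Some 4.
Proof.
move=> tf cyc w4; apply/min_nat_SomeP; split; first by exists c.
by move=> n [c' cyc' <-]; apply: triangle_free_weight_ge4.
Qed.

Lemma girth4_of_LLH (x y z : V) : triangle_free (light G) ->
  light G x y -> light G y z -> heavy G x z -> girth G = Some 4.
Proof.
move=> tf Lxy Lyz Hxz; have Hzx : heavy G z x by rewrite edge_sym.
have U : uniq [:: x; y; z].
  by rewrite /= !inE negb_or (sgraph_neq Lxy) (sgraph_neq Hxz) (sgraph_neq Lyz).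
apply: (@girth4_of_cycle [:: x; y; z]) => //.
  by split=> //; rewrite /ucycle U /= /adj Lxy Lyz Hzx !orbT.
by rewrite weight3 // (edge_weight_heavy Hzx) !edge_weight_light.
Qed.

Lemma girth4_of_LLLL (x y z t : V) : triangle_free (light G) ->
  light G x y -> light G y z -> light G z t -> light G t x ->
  x != z -> y != t -> girth G = Some 4.
Proof.
move=> tf Lxy Lyz Lzt Ltx xz yt.
have U : uniq [:: x; y; z; t].
  rewrite /= !inE !negb_or (sgraph_neq Lxy) xz eq_sym (sgraph_neq Ltx).
  by rewrite (sgraph_neq Lyz) yt (sgraph_neq Lzt).
apply: (@girth4_of_cycle [:: x; y; z; t]) => //.
  by split=> //; rewrite /ucycle U /= /adj Lxy Lyz Lzt Ltx.
by rewrite weight4 // !edge_weight_light.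
Qed.

(** A cycle of weight 4 is a triangle with exactly one heavy edge or a light 4-cycle; both contain
    two consecutive light edges. The path yields [2 <= a] and a light edge from which the counting
    bounds start. *)
Lemma girth4_light_path : girth G = Some 4 ->
  exists x y z, [/\ light G x y, light G y z & x != z].
Proof.
move/min_nat_SomeP=> [[c [c3 cyc] w4] _].
have := size_le_weight c; rewrite w4.
case: c cyc c3 w4 => [|x [|y [|z [|t [|? ?]]]]] //= /andP[/=].
- rewrite andbT => /and3P[xy yz zx] U _; rewrite weight3 // => w4 _.
  move: U; rewrite /= !inE negb_or !andbT => /andP[/andP[nxy nxz] nyz].
  move: xy yz zx w4; rewrite /adj /edge_weight.
  case: (heavy G x y) (heavy G y z) (heavy G z x) => [] [] []//.
  + rewrite !orbF => _ yz zx _; exists y, z, x; split=> //.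
    by rewrite eq_sym.
  + rewrite !orbF => xy _ zx _; exists z, x, y; split=> //.
    by rewrite eq_sym.
  + by rewrite !orbF => xy yz _ _; exists x, y, z.
rewrite andbT => /and4P[xy yz zt tx] U _; rewrite weight4 // => w4 _.
move: U; rewrite /= !inE !negb_or => /andP[/and3P[_ nxz _] _].
move: xy yz w4; rewrite /adj /edge_weight.
case: (heavy G x y) (heavy G y z) => [] [];
  do 2!case: ifP => _ //.
by rewrite !orbF => xy yz _; exists x, y, z.
Qed.

End GirthFour.

(** * Handshakes and lower bounds on the order *)

Lemma card_set_sum (V : finType) (P : pred V) :
  #|[set y | P y]| = \sum_y (P y : nat).
Proof. by rewrite -sum1dep_card big_mkcond; apply: eq_bigr => y _; case: (P y). Qed.

(** Orienting each edge by the enumeration ranks of its ends splits the degree sum into two sums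
    that agree after exchanging [u] and [v]. Sets [A] other than the whole vertex set serve for one
    side of a bipartite light graph. *)
Lemma handshake (V : finType) (e : sgraph V) (A : {set V}) :
  ~~ odd (\sum_(u in A) #|[set v in A | e u v]|).
Proof.
pose lo u v := (enum_rank u < enum_rank v) && e u v.
have split_edges u v : (e u v : nat) = lo u v + lo v u.
  rewrite /lo (edge_sym e v u); case: (boolP (e u v)); rewrite ?andbF // => euv.
  have : enum_rank u != enum_rank v.
    by rewrite (inj_eq enum_rank_inj) (sgraph_neq euv).
  by rewrite !andbT -val_eqE /=; case: ltngtP.
have -> : \sum_(u in A) #|[set v in A | e u v]| =
   \sum_(u in A) \sum_(v in A) lo u v + \sum_(u in A) \sum_(v in A) lo v u.
  rewrite -big_split; apply: eq_bigr => u uA.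
  rewrite -big_split card_set_sum [RHS]big_mkcond; apply: eq_bigr => v _.
  by case: (v \in A) => //=; rewrite split_edges.
by rewrite [X in _ + X]exchange_big addnn odd_double.
Qed.

Section LowerBounds.

Variables (V : finType) (L : sgraph V) (a : nat).
Hypotheses (regL : regular a L) (tfL : triangle_free L).

Let N (x : V) := [set y | L x y].

Lemma regular_even_order d (K : sgraph V) : regular d K -> ~~ odd (#|V| * d).
Proof.
move=> regK; have := handshake K [set: V].
rewrite (eq_bigr (fun=> d)) ?sum_nat_const ?cardsT // => u _.
by rewrite -[RHS](regK u); congr #|pred_of_set _|; apply/setP=> v; rewrite !inE.
Qed.

Lemma disjoint_neighbors (x y : V) : L x y -> [disjoint N x & N y].
Proof.
move=> Lxy; rewrite -setI_eq0; apply/eqP/setP=> z; rewrite !inE.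
apply/negP=> /andP[Lxz Lyz]; by have := tfL Lxy Lyz; rewrite Lxz.
Qed.

Lemma neighborsU (x y : V) : L x y -> #|N x :|: N y| = 2 * a.
Proof.
move=> Lxy; rewrite cardsU; have := disjoint_neighbors Lxy.
rewrite -setI_eq0 => /eqP->; rewrite cards0 subn0 /N !regL; lia.
Qed.

Lemma triangle_free_order (x y : V) : L x y -> 2 * a <= #|V|.
Proof. by move=> Lxy; rewrite -(neighborsU Lxy) max_card. Qed.

(** Adjacent vertices have no common neighbour, so each [u] is joined to at most two of the five;
    summing over [u] bounds the five degrees. *)
Lemma five_cycle_order (v0 v1 v2 v3 v4 : V) :
  L v0 v1 -> L v1 v2 -> L v2 v3 -> L v3 v4 -> L v4 v0 -> 5 * a <= 2 * #|V|.
Proof.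
move=> e01 e12 e23 e34 e40.
have -> : 5 * a = #|N v0| + (#|N v1| + (#|N v2| + (#|N v3| + #|N v4|))).
  rewrite /N !regL; lia.
rewrite !card_set_sum -!big_split /= -sum1_card big_distrr /=.
apply: leq_sum => u _.
have excl x y : L x y -> ~~ (L x u && L y u).
  by move=> Lxy; apply/negP=> /andP[Lxu Lyu]; have := tfL Lxy Lyu; rewrite Lxu.
move: (excl _ _ e01) (excl _ _ e12) (excl _ _ e23) (excl _ _ e34) (excl _ _ e40).
by case: (L v0 u) (L v1 u) (L v2 u) (L v3 u) (L v4 u) => [] [] [] [] [].
Qed.

(** Counting the edges between [P] and its complement from both sides shows that the two have the
    same size. *)
Lemma bipartite_regular_even (P : {set V}) : 0 < a ->
  (forall u v, L u v -> (u \in P) = (v \notin P)) -> ~~ odd #|V|.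
Proof.
move=> a_gt0 bip.
have degP : \sum_(u in P) \sum_(v in ~: P) (L u v : nat) = #|P| * a.
  rewrite -sum_nat_const; apply: eq_bigr => u uP.
  rewrite -(regL u) card_set_sum big_mkcond; apply: eq_bigr => v _.
  rewrite inE; case: (boolP (L u v)) => [/bip|]; last by case: ifP.
  by rewrite uP => <-.
have degQ : \sum_(v in ~: P) \sum_(u in P) (L u v : nat) = #|~: P| * a.
  rewrite -sum_nat_const; apply: eq_bigr => v; rewrite inE => vP.
  rewrite -(regL v) card_set_sum big_mkcond; apply: eq_bigr => u _.
  rewrite edge_sym; case: (boolP (L v u)) => [/bip|]; last by case: ifP.
  by rewrite (negbTE vP) => /esym/negbFE ->.
move: degQ; rewrite exchange_big degP => /eqP; rewrite eqn_pmul2r // => /eqP eqPQ.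
by rewrite -(cardsC P) -eqPQ addnn odd_double.
Qed.

(* Andrasfai's bound for regular graphs. For an edge xy, a vertex with
   neighbours in both N(x) and N(y) lies on a 5-cycle with x and y, and three
   pairwise disjoint neighbourhoods do not fit; hence having a neighbour in
   N(x) or in N(y) is a bipartition. *)
Lemma dense_triangle_free_even : 2 * #|V| < 5 * a -> ~~ odd #|V|.
Proof.
move=> dense; have a_gt0 : 0 < a by lia.
have [x|noV] := pickP (mem V); last by rewrite eq_card0.
move=> _; have /card_gt0P[y] : 0 < #|N x| by rewrite /N regL.
rewrite inE => Lxy.
pose hits v w := [exists u, L v u && L w u].
have three u v w : [disjoint N u & N v] -> [disjoint N u & N w] ->
    [disjoint N v & N w] -> False.
  rewrite -!setI_eq0 => /eqP uv /eqP uw /eqP vw.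
  have := max_card (mem (N u :|: N v :|: N w)).
  rewrite !cardsU setIUl uv uw vw setU0 cards0 /N !regL; lia.
have nohit v w : ~~ hits v w -> [disjoint N v & N w].
  rewrite /hits negb_exists => /forallP vw; rewrite -setI_eq0.
  by apply/eqP/setP=> u; rewrite !inE; apply/negbTE/vw.
have hit1 v : hits v x || hits v y.
  rewrite -[_ || _]negbK negb_or; apply/negP=> /andP[/nohit vx /nohit vy].
  exact: (three _ _ _ vx vy (disjoint_neighbors Lxy)).
have hit2 v : hits v x -> ~~ hits v y.
  move=> /existsP[u /andP[vu xu]]; apply/negP=> /existsP[w /andP[vw yw]].
  suff: 5 * a <= 2 * #|V| by lia.
  apply: (@five_cycle_order v u x y w) => //; by rewrite edge_sym.
apply: (@bipartite_regular_even [set v | hits v x]) => // u v Luv.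
rewrite !inE; case: (boolP (hits u x)) => ux; case: (boolP (hits v x)) => vx //=.
  case: (three u v y) => //; [exact: disjoint_neighbors|exact/nohit/hit2..].
by case: (three u v x); [exact: disjoint_neighbors|exact: nohit..].
Qed.

(** On [2 * a] vertices the heavy edges at [N x] would stay inside [N x], so [H] would induce there
    a graph of odd degree [b] on an odd number [a] of vertices. *)
Lemma odd_degrees_order (b : nat) (H : sgraph V) (x y : V) :
  regular b H -> (forall u v, ~~ (L u v && H u v)) ->
  L x y -> odd a -> odd b -> #|V| != 2 * a.
Proof.
move=> regH disj Lxy a_odd b_odd; apply/eqP=> cardV.
(* [N u] avoids [N x] by triangle-freeness, and its [a] elements fill the complement. *)
have compl u : L x u -> N u = ~: N x.
  move=> Lxu; apply/eqP; rewrite eqEcard; apply/andP; split.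
    apply/subsetP=> v; rewrite !inE => Luv; exact: tfL Lxu Luv.
  have := cardsC (N x); rewrite cardV /N !regL; lia.
have := handshake H (N x).
rewrite (eq_bigr (fun=> b)); first by rewrite sum_nat_const /N regL oddM a_odd b_odd.
move=> u; rewrite inE => Lxu; rewrite -(regH u); congr #|pred_of_set _|.
apply/setP=> v; rewrite !inE andb_idl // => Huv.
have := disj u v; rewrite Huv andbT => nLuv.
by have /setP/(_ v) := compl _ Lxu; rewrite !inE (negbTE nLuv) => /esym/negbFE.
Qed.

End LowerBounds.

Lemma degree_sum_order (V : finType) (a b : nat) (G : wgraph V) (x : V) :
  ab_regular a b G -> a + b + 1 <= #|V|.
Proof.
move=> [regL regH].
have := max_card (mem (x |: ([set y | light G x y] :|: [set y | heavy G x y]))).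
rewrite cardsU1 !inE !edge_irr cardsU regL regH.
rewrite (_ : _ :&: _ = set0) ?cards0; first by lia.
by apply/setP=> y; rewrite !inE; apply/negbTE/light_heavy_disjoint.
Qed.

(** * Heavy graph as the complement of the light one *)

Definition realizable (a b n : nat) : Prop :=
  exists (V : finType) (G : wgraph V), #|V| = n /\ abg_wgraph a b 4 G.

Section Complement.

Variables (V : finType) (L : sgraph V).

Definition complement_rel : rel V := fun x y => (x != y) && ~~ L x y.

Lemma complement_rel_sym : symmetric complement_rel.
Proof. by move=> x y; rewrite /complement_rel eq_sym edge_sym. Qed.

Lemma complement_rel_irr : irreflexive complement_rel.
Proof. by move=> x; rewrite /complement_rel eqxx. Qed.

Definition complement_graph := SGraph complement_rel_sym complement_rel_irr.

Lemma complement_disjoint x y : ~~ (L x y && complement_graph x y).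
Proof. by rewrite /= /complement_rel; case: (L x y); rewrite ?andbF. Qed.

(** The order makes the complement [b]-regular, and two light neighbours of a vertex are never
    light-adjacent, so a heavy edge closes their path to weight 4. Realizing [a + b + 1] thus
    reduces to finding [L]. *)
Lemma realizable_complement (a b : nat) : 2 <= a -> #|V| = a + b + 1 ->
  regular a L -> triangle_free L -> realizable a b (a + b + 1).
Proof.
move=> a2 cardV regL tfL; exists V, (WGraph complement_disjoint).
split=> //; split; first split=> //=.
  move=> x; have -> : [set y | complement_rel x y] = ~: (x |: [set y | L x y]).
    by apply/setP=> y; rewrite !inE negb_or eq_sym.
  have := cardsC (x |: [set y | L x y]).
  by rewrite cardsU1 inE edge_irr regL cardV; lia.
have /card_gt0P[y _] : 0 < #|V| by rewrite cardV addn1.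
have : 1 < #|[set z | L y z]| by rewrite regL.
move=> /card_gt1P[x [z [/[!inE] Lyx Lyz xz]]].
have Lxy : L x y by rewrite edge_sym.
apply: (@girth4_of_LLH _ _ x y z) => //=.
by rewrite /complement_rel xz; apply: tfL Lxy Lyz.
Qed.

End Complement.

(** * Circulants and graphs on two copies of a cyclic group *)

Lemma sum_ltn_ord (n q : nat) : q <= n -> \sum_(d < n) (d < q : nat) = q.
Proof.
move=> q_le; rewrite -[RHS]card_ord -sum1_card (big_ord_widen n (fun=> 1) q_le).
by rewrite [RHS]big_mkcond; apply: eq_bigr => d _; case: ltnP.
Qed.

Lemma sum_double (m : nat) (F : bool * 'I_m.+1 -> nat) :
  \sum_p F p = \sum_y F (true, y) + \sum_y F (false, y).
Proof.
rewrite (eq_bigr (fun p => F (p.1, p.2))); last by case.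
by rewrite -(pair_bigA _ (fun i y => F (i, y))) big_bool.
Qed.

Section DoubleGraphs.

Variable m : nat.

(** Connection set of a circulant: the [b./2] nearest residues on either side of 0, and the antipode
    when [b] is odd. *)
Definition circulant_set (b : nat) : pred 'I_m.+1 := fun d =>
  (0 < d) && [|| d <= b./2, m.+1 - d <= b./2 | odd b && (d.*2 == m.+1)].

Lemma circulant_set0 b : circulant_set b 0%R = false.
Proof. by []. Qed.

Lemma circulant_setN b d : circulant_set b (- d)%R = circulant_set b d.
Proof.
have := ltn_ord d; rewrite /circulant_set /=; case: (posnP d) => [-> _|d_gt0 d_lt].
  by rewrite subn0 modnn.
by rewrite modn_small; lia.
Qed.

Lemma card_circulant_set b : b < m.+1 -> ~~ odd (m.+1 * b) ->
  #|[set d | circulant_set b d]| = b.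
Proof.
rewrite oddM card_set_sum => b_lt even_mb; set h := b./2; set c := m.+1./2.
have := odd_double_half b; have := odd_double_half m.+1; rewrite -/h -/c => defm defb.
(* Each arc, and the antipode [c], is a difference of initial segments; the subtracted segments are
   moved to the left to stay in [nat]. *)
have key : \sum_(d < m.+1) ((circulant_set b d : nat) + (d < 1 : nat)
    + (d < m.+1 - h : nat) + odd b * (d < c : nat)) =
  \sum_(d < m.+1) ((d < h.+1 : nat) + (d < m.+1 : nat) + odd b * (d < c.+1 : nat)).
  apply: eq_bigr => d _; have := ltn_ord d; rewrite /circulant_set -/h.
  move: even_mb defm defb; case: (odd b); case: (odd m.+1) => //=; lia.
have sum_mul q : q <= m.+1 -> \sum_(d < m.+1) odd b * (d < q : nat) = odd b * q.
  by move=> q_le; rewrite -big_distrr /= sum_ltn_ord.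
move: key; rewrite !big_split /= !sum_mul ?sum_ltn_ord.
all: lia.
Qed.

(** Across the sides the sum is used because it is symmetric in the two ends, leaving [S] arbitrary;
    differences within a side need [T] closed under negation. *)
Definition double_rel (T S : pred 'I_m.+1) : rel (bool * 'I_m.+1) :=
  fun u v => if u.1 == v.1 then T (v.2 - u.2)%R else S (u.2 + v.2)%R.

Lemma double_rel_sym T S : (forall d, T (- d)%R = T d) ->
  symmetric (double_rel T S).
Proof. by move=> TN u v; rewrite /double_rel eq_sym -TN opprB [(u.2 + _)%R]addrC. Qed.

Lemma double_rel_irr T S : T 0%R = false -> irreflexive (double_rel T S).
Proof. by move=> T0 u; rewrite /double_rel eqxx subrr. Qed.

Definition double_graph T S TN T0 :=
  SGraph (@double_rel_sym T S TN) (double_rel_irr S T0).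

Lemma double_graph_regular T S TN T0 :
  regular (#|[set d | T d]| + #|[set s | S s]|) (@double_graph T S TN T0).
Proof.
move=> [i x]; rewrite card_set_sum.
have cardT : \sum_y (T (y - x)%R : nat) = #|[set d | T d]|.
  by rewrite -card_set_sum -[RHS](card_preimset _ (addIr (- x)%R)) ; apply: eq_card => y; rewrite !inE.
have cardS : \sum_y (S (x + y)%R : nat) = #|[set s | S s]|.
  by rewrite -card_set_sum -[RHS](card_preimset _ (addrI x)); apply: eq_card => y; rewrite !inE.
by rewrite sum_double /double_rel /=; case: i; rewrite /= cardT cardS // addnC.
Qed.

Definition bipartite_graph (S : pred 'I_m.+1) : sgraph (bool * 'I_m.+1)%type :=
  @double_graph pred0 S (fun=> erefl) erefl.

Lemma bipartite_graph_regular S : regular #|[set s | S s]| (bipartite_graph S).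
Proof.
by move=> u; rewrite double_graph_regular; rewrite [X in X + _]eq_card0 // => d; rewrite inE.
Qed.

Lemma bipartite_graph_triangle_free S : triangle_free (bipartite_graph S).
Proof.
move=> [i x] [j y] [k z]; rewrite /= /double_rel /=.
by case: i j k => [] [] [].
Qed.

Section DoubleWGraph.

Variables (S T U : pred 'I_m.+1).
Hypotheses (TN : forall d, T (- d)%R = T d) (T0 : T 0%R = false).
Hypothesis SU : forall s, ~~ (S s && U s).

Lemma double_disjoint u v :
  ~~ (bipartite_graph S u v && double_graph U TN T0 u v).
Proof. by rewrite /= /double_rel; case: ifP. Qed.

Definition double_wgraph := WGraph double_disjoint.

Lemma double_wgraph_regular a b :
  #|[set s | S s]| = a -> #|[set d | T d]| + #|[set s | U s]| = b ->
  ab_regular a b double_wgraph.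
Proof.
by move=> <- <-; split; [exact: bipartite_graph_regular | exact: double_graph_regular].
Qed.

End DoubleWGraph.

End DoubleGraphs.

(** * Constructions of even order *)

Lemma card_double (m : nat) : #|{: bool * 'I_m.+1}| = 2 * m.+1.
Proof. by rewrite card_prod card_bool card_ord. Qed.

Lemma card_ltn_ord (n q : nat) : q <= n -> #|[set d : 'I_n | d < q]| = q.
Proof. by move=> q_le; rewrite card_set_sum sum_ltn_ord. Qed.

Lemma card_geq_ord (n q : nat) : q <= n -> #|[set d : 'I_n | q <= d]| = n - q.
Proof.
move=> q_le; have := cardsC [set d : 'I_n | d < q]; rewrite card_ltn_ord // card_ord.
rewrite (_ : ~: _ = [set d : 'I_n | q <= d]); first by lia.
by apply/setP=> d; rewrite !inE -leqNgt.
Qed.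

(** [L] is complete bipartite with sides of size [a], and [H] is a [b]-regular circulant on each
    side. *)
Lemma realizable_double_order (a b : nat) :
  2 <= a -> b < a -> ~~ odd (a * b) -> realizable a b (2 * a).
Proof.
case: a => [|[|m]] // _ b_lt even_ab.
exists _, (@double_wgraph m.+1 predT (circulant_set b) pred0 (circulant_setN b)
  (circulant_set0 _ b) (fun=> isT)).
split; first exact: card_double.
split; first apply: double_wgraph_regular.
- by rewrite -[RHS]card_ord -cardsT; apply: eq_card => s; rewrite !inE.
- have -> : [set s : 'I_m.+2 | pred0 s] = set0 by apply/setP=> s; rewrite !inE.
  by rewrite cards0 addn0 card_circulant_set.
apply: (@girth4_of_LLLL _ _ (false, ord0) (true, ord0) (false, ord_max) (true, ord_max)) => //.
exact: bipartite_graph_triangle_free.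
Qed.

(** Sides of even size [a + 1] carry [b]-regular circulants; [L] is complete bipartite minus the
    perfect matching of sum 0. *)
Lemma realizable_double_order_add2 (a b : nat) :
  3 <= a -> b <= a -> odd a -> realizable a b (2 * a + 2).
Proof.
move=> a3 b_le a_odd.
have SU (s : 'I_a.+1) : ~~ ((s != 0%R) && pred0 s) by rewrite andbF.
exists _, (double_wgraph (circulant_setN b) (circulant_set0 _ b) SU).
split; first by rewrite card_double; lia.
split; first apply: double_wgraph_regular.
- transitivity #|[set~ (0%R : 'I_a.+1)]|; last by rewrite cardsC1 card_ord.
  by apply: eq_card => s; rewrite !inE.
- have -> : [set s : 'I_a.+1 | pred0 s] = set0 by apply/setP=> s; rewrite !inE.
  by rewrite cards0 addn0 card_circulant_set // oddM /= a_odd.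
have val_inord i : i <= 3 -> (inord i : 'I_a.+1) = i :> nat.
  by move=> i3; rewrite inordK // ltnS (leq_trans i3).
(* The four edges have sums 1, 2, 3, 2, all nonzero modulo [a + 1] since [a + 1 >= 4]. *)
apply: (@girth4_of_LLLL _ _ (false, inord 0) (true, inord 1) (false, inord 1)
  (true, inord 2)); first exact: bipartite_graph_triangle_free.
1-4: by rewrite /= /double_rel /= -val_eqE /= !val_inord // modn_small //; lia.
all: by rewrite xpair_eqE /= -val_eqE /= !val_inord.
Qed.

(** [H] is the complement of [L] minus a perfect matching: both sides are heavy cliques, sums below
    [a] are light, sums above [a] heavy, and the sum [a] is left out. *)
Lemma realizable_sum_add2 (a b m : nat) :
  2 <= a -> a <= m -> a + b + 2 = 2 * m.+1 -> realizable a b (a + b + 2).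
Proof.
move=> a2 a_le def_n.
have SU (s : 'I_m.+1) : ~~ ((s < a) && (a < s)) by case: ltngtP.
have TN (d : 'I_m.+1) : ((- d)%R != 0%R) = (d != 0%R) by rewrite oppr_eq0.
have T0 : (0%R : 'I_m.+1) != 0%R = false by rewrite eqxx.
exists _, (@double_wgraph m _ (fun s => s != 0%R) _ TN T0 SU).
split; first by rewrite card_double.
split; first apply: double_wgraph_regular.
- by rewrite card_ltn_ord // ltnW.
- rewrite card_geq_ord //.
  have -> : [set d : 'I_m.+1 | d != 0%R] = [set~ 0%R] by apply/setP=> d; rewrite !inE.
  by rewrite cardsC1 card_ord; lia.
apply: (@girth4_of_LLH _ _ (false, ord0) (true, ord0) (false, inord 1)).
- exact: bipartite_graph_triangle_free.
- by rewrite /= /double_rel /= modn_small //; lia.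
- by rewrite /= /double_rel /= inordK ?modn_small //; lia.
by rewrite /= /double_rel /= subr0 -val_eqE /= inordK //; lia.
Qed.

Lemma realizable_sum_even (a b m : nat) :
  2 <= a -> a <= m.+1 -> a + b + 1 = 2 * m.+1 -> realizable a b (a + b + 1).
Proof.
move=> a2 a_le def_n.
apply: (@realizable_complement _ (@bipartite_graph m (fun s => s < a))) => //.
- by rewrite card_double.
- by move=> u; rewrite bipartite_graph_regular card_ltn_ord.
- exact: bipartite_graph_triangle_free.
Qed.

(** * Construction of odd order *)

Section BlownUpPentagon.

Variables (m k t : nat) (d : bool).

(* A pentagon with classes A, (b, x < k) and (b, x >= k) for b : bool, where
   A = 'I_t is joined to both low classes. Joining opposite copies along the
   offsets alone gives degree 2k, and degree t between the two low classes;
   those edges are traded for the edges to A. The deleted offset k - 1 gives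
   t = k - 1, needed when k is even because t must be odd. *)
Definition pentagon_offset (s : 'I_m.+1) : bool :=
  (s < 2 * k + d) && ~~ (d && (s == k.-1 :> nat)).

Definition pentagon_rel : rel ('I_t + bool * 'I_m.+1) := fun u v =>
  match u, v with
  | inl _, inl _ => false
  | inl _, inr (_, x) => x < k
  | inr (_, x), inl _ => x < k
  | inr (i, x), inr (j, y) =>
      [&& i != j, pentagon_offset (x + y)%R & ~~ ((x < k) && (y < k))]
  end.

Lemma pentagon_rel_sym : symmetric pentagon_rel.
Proof.
by move=> [a|[i x]] [b|[j y]] //=; rewrite eq_sym addrC [(x < k) && _]andbC.
Qed.

Lemma pentagon_rel_irr : irreflexive pentagon_rel.
Proof. by move=> [a|[i x]] //=; rewrite eqxx. Qed.

Definition pentagon_graph := SGraph pentagon_rel_sym pentagon_rel_irr.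

Lemma pentagon_triangle_free : triangle_free pentagon_graph.
Proof.
move=> [a|[i x]] [b|[j y]] [c|[l z]] //=.
- by move=> yk /and3P[_ _]; rewrite yk.
- by move=> xk yk; rewrite xk yk !andbF.
- by move=> /and3P[_ _]; rewrite negb_and => /orP[/negbTE->|/negbTE->].
by case: i j l => [] [] [].
Qed.

Hypotheses (k_gt0 : 0 < k) (def_k : t + d = k) (m_ge : 2 * k + d <= m.+1).

Let sum_mul q : q <= m.+1 ->
  \sum_(s < m.+1) d * (s < q : nat) = d * q.
Proof. by move=> q_le; rewrite -big_distrr /= sum_ltn_ord. Qed.

Lemma sum_pentagon_offset (x : 'I_m.+1) :
  \sum_y (pentagon_offset (x + y)%R : nat) = 2 * k.
Proof.
rewrite -card_set_sum; transitivity #|[set s | pentagon_offset s]|.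
  by rewrite -[RHS](card_preimset _ (addrI x)); apply: eq_card => y; rewrite !inE.
rewrite card_set_sum.
(* The deleted offset [k.-1] is the difference of the segments below [k] and below [k.-1]. *)
have key : \sum_(s < m.+1) ((pentagon_offset s : nat) + d * (s < k : nat)) =
  \sum_(s < m.+1) ((s < 2 * k + d : nat) + d * (s < k.-1 : nat)).
  by apply: eq_bigr => s _; rewrite /pentagon_offset; case: d => /=; lia.
move: key; rewrite !big_split /= !sum_mul ?sum_ltn_ord; lia.
Qed.

Lemma sum_pentagon_low (x : 'I_m.+1) : x < k ->
  \sum_y (pentagon_offset (x + y)%R && (y < k) : nat) = t.
Proof.
move=> xk.
(* For low [x] and [y] the sum does not wrap around, so the only low [y] that can be lost is
   [k.-1 - x]. *)
have key : \sum_(y < m.+1) ((pentagon_offset (x + y)%R && (y < k) : nat)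
     + d * (y < k - x : nat)) =
  \sum_(y < m.+1) ((y < k : nat) + d * (y < k.-1 - x : nat)).
  apply: eq_bigr => y _; rewrite /pentagon_offset.
  case: (ltnP y k) => yk; last by rewrite andbF; case: d => /=; lia.
  by rewrite /= modn_small; last lia; case: d => /=; lia.
move: key; rewrite !big_split /= !sum_mul ?sum_ltn_ord; try lia.
by move=> key; apply/eqP; rewrite -(eqn_add2r (d * (k - x))) key; move: def_k; case: d; lia.
Qed.

(** A vertex of A sees the [2 * k] low vertices; a low vertex trades [t] low neighbours for the [t]
    vertices of A; a high vertex keeps all [2 * k] offsets. *)
Lemma pentagon_regular : regular (2 * k) pentagon_graph.
Proof.
move=> [a|[i x]]; rewrite card_set_sum big_sumType /=.
  by rewrite big1 // add0n sum_double /= !sum_ltn_ord; lia.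
rewrite sum_nat_const card_ord sum_double /=.
set D := \sum_y (pentagon_offset (x + y)%R && ~~ ((x < k) && (y < k)) : nat).
rewrite (_ : _ + _ = t * (x < k) + D); last first.
  by congr (_ + _); rewrite /D; case: i => /=; rewrite sum_nat_const muln0 ?addn0 ?add0n.
rewrite /D; case: (ltnP x k) => xk /=.
  have := sum_pentagon_offset x; rewrite -{1}(sum_pentagon_low xk) muln1 -big_split /= => <-.
  by apply: eq_bigr => y _; case: (pentagon_offset _); case: (y < k).
rewrite muln0 add0n -[RHS](sum_pentagon_offset x).
by apply: eq_bigr => y _; rewrite andbT.
Qed.

End BlownUpPentagon.

Lemma realizable_sum_odd (k b : nat) : 0 < k -> ~~ odd b ->
  5 * k <= 2 * k + b + 1 -> realizable (2 * k) b (2 * k + b + 1).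
Proof.
(* The order is odd, so [d] is chosen to make [t] odd; the remaining even number of vertices forms
   the two copies. *)
move=> k_gt0 b_even n_ge; pose d := ~~ odd k; pose t := k - d.
pose m := ((2 * k + b + 1 - t)./2).-1.
have d_le : d <= k by rewrite /d; case: (odd k) => //=; lia.
have def_k : t + d = k by rewrite /t subnK.
have def_n : t + 2 * m.+1 = 2 * k + b + 1.
  rewrite /m /t /d; move: b_even n_ge; case: (boolP (odd k)); lia.
(* [2 * m.+1] is the order minus [k - d], hence at least [4 * k + d]; when [d] is 1, evenness raises
   this to [4 * k + 2]. *)
have m_ge : 2 * k + d <= m.+1 by rewrite /d in def_k *; lia.
apply: (@realizable_complement _ (pentagon_graph m k t d)); first by lia.
- by rewrite card_sum card_ord card_double.
- exact: pentagon_regular.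
- exact: pentagon_triangle_free.
Qed.

(** * Matching the bounds case by case *)

Lemma min_order_eq (a b n : nat) : realizable a b n ->
  (forall (V : finType) (G : wgraph V), abg_wgraph a b 4 G -> n <= #|V|) ->
  min_order a b 4 = Some n.
Proof.
move=> real_n lb; apply/min_nat_SomeP; split=> // p [V [G [<- abgG]]].
exact: lb abgG.
Qed.

Lemma abg4_order_constraints (a b : nat) (V : finType) (G : wgraph V) :
  abg_wgraph a b 4 G ->
  [/\ 2 <= a, a + b + 1 <= #|V|, 2 * a <= #|V|,
      ~~ odd (#|V| * a) && ~~ odd (#|V| * b)
    & (odd a -> odd b -> #|V| != 2 * a) /\
      (2 * #|V| < 5 * a -> ~~ odd #|V|)].
Proof.
move=> abgG; have [[regL regH] g4] := abgG; have tf := girth4_triangle_free g4.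
have [x [y [z [Lxy Lyz xz]]]] := girth4_light_path g4.
split.
- rewrite -(regL y); apply/card_gt1P; exists x, z; rewrite !inE Lyz.
  by rewrite edge_sym Lxy.
- exact: degree_sum_order x (proj1 abgG).
- exact: triangle_free_order regL tf _ _ Lxy.
- by rewrite (regular_even_order regL) (regular_even_order regH).
split; last exact: dense_triangle_free_even regL tf.
by apply: (odd_degrees_order regL tf regH _ Lxy); apply: light_heavy_disjoint.
Qed.

Theorem theorem15 (a b : nat) :
  (a < 2 -> min_order a b 4 = None) /\
  (a = 2 -> b = 0 -> min_order a b 4 = Some (2 * a)) /\
  (a = 2 -> 1 <= b -> min_order a b 4 = Some (a + b + 1)) /\
  (3 <= a -> b < a -> ~~ odd (a * b) -> min_order a b 4 = Some (2 * a)) /\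
  (3 <= a -> b < a -> odd (a * b) -> min_order a b 4 = Some (2 * a + 2)) /\
  (3 <= a -> a <= b -> a != b %[mod 2] ->
     min_order a b 4 = Some (a + b + 1)) /\
  (3 <= a -> a <= b -> odd a -> odd b ->
     min_order a b 4 = Some (a + b + 2)) /\
  (3 <= a -> a <= b -> ~~ odd a -> ~~ odd b ->
     (b%:R <= 3 * a%:R / 2 - 2 :> rat)%R ->
     min_order a b 4 = Some (a + b + 2)) /\
  (3 <= a -> a <= b -> ~~ odd a -> ~~ odd b ->
     (b%:R > 3 * a%:R / 2 - 2 :> rat)%R ->
     min_order a b 4 = Some (a + b + 1)).
Proof.
have rat_le : ((b%:R <= 3 * a%:R / 2 - 2 :> rat)%R) = (2 * b + 4 <= 3 * a).
  rewrite -(Num.Theory.ler_nat rat) natrD !natrM; apply/idP/idP; lra.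
have rat_lt : ((b%:R > 3 * a%:R / 2 - 2 :> rat)%R) = (3 * a < 2 * b + 4).
  rewrite -(Num.Theory.ltr_nat rat) natrD !natrM; apply/idP/idP; lra.
have sum_even : 2 <= a -> a <= b.+1 -> odd (a + b) -> realizable a b (a + b + 1).
  by move=> a2 ab odd_ab; apply: (@realizable_sum_even a b ((a + b + 1)./2).-1); lia.
have sum_odd : 2 <= a -> ~~ odd a -> ~~ odd b -> 3 * a < 2 * b + 4 ->
    realizable a b (a + b + 1).
  move=> a2 ea eb ab; have -> : a = 2 * a./2 by lia.
  by apply: realizable_sum_odd; lia.
have sum_add2 : 2 <= a -> a <= b -> odd a = odd b -> realizable a b (a + b + 2).
  by move=> a2 ab odd_ab; apply: (@realizable_sum_add2 a b ((a + b)./2)); lia.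
split=> [a1|].
  apply/min_nat_NoneP=> n [V [G [_ abgG]]].
  by have [] := abg4_order_constraints abgG; lia.
split=> [a2 b0|].
  apply: min_order_eq; first by apply: realizable_double_order; lia.
  by move=> V G /abg4_order_constraints[].
split=> [a2 b1|].
  apply: min_order_eq; last by move=> V G /abg4_order_constraints[].
  (* The case [b = 1] is why [sum_even] allows [a = b.+1]; an even [b] is at least 2, as [sum_odd]
     needs. *)
  by case: (boolP (odd b)) => ob; [apply: sum_even | apply: sum_odd]; lia.
split=> [a3 ba even_ab|].
  apply: min_order_eq; first by apply: realizable_double_order; lia.
  by move=> V G /abg4_order_constraints[].
split=> [a3 ba odd_ab|].
  move: odd_ab; rewrite oddM => /andP[oa ob].
  apply: min_order_eq; first by apply: realizable_double_order_add2; lia.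
  (* Odd degrees make the order even, and it exceeds [2 * a]. *)
  move=> V G /abg4_order_constraints[_ _ n_ge]; rewrite !oddM oa ob !andbT.
  by move=> n_even [/(_ isT isT) + _]; lia.
split=> [a3 ab ab2|].
  apply: min_order_eq; last by move=> V G /abg4_order_constraints[].
  by apply: sum_even; lia.
split=> [a3 ab oa ob|].
  apply: min_order_eq; first by apply: sum_add2; lia.
  (* The order is even, whereas [a + b + 1] is odd. *)
  move=> V G /abg4_order_constraints[_ n_ge _]; rewrite !oddM oa ob !andbT.
  by move=> n_even _; lia.
split=> [a3 ab ea eb|a3 ab ea eb].
  rewrite rat_le => b_le; apply: min_order_eq; first by apply: sum_add2; lia.
  (* The order [a + b + 1] is odd, but [2 * b + 4 <= 3 * a] gives [2 * (a + b + 1) < 5 * a], which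
     would make it even. *)
  by move=> V G /abg4_order_constraints[_ n_ge _ _ [_ dense]]; lia.
rewrite rat_lt => b_gt; apply: min_order_eq; first by apply: sum_odd; lia.
by move=> V G /abg4_order_constraints[].
Qed.
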